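(* Let $\mathcal{B}$ be a design over $\mathbb{F}_2$ with parameters $2$-$(v,k,\lambda_2)$, let $G\le GL_v(2)$ be an automorphism group of $\mathcal{B}$, and let $\Psi=\Psi_1\sqcup\cdots\sqcup\Psi_m$, $\mathcal{B}=\mathcal{B}_1\sqcup\cdots\sqcup\mathcal{B}_n$ be the tactical decomposition given by the $G$-orbits on points and on blocks. Fix $l,r,s\in\{1,\dots,m\}$, a point $P\in\Psi_l$ and a point $R\in\Psi_r$. For $i=1,2,3$ let $\Psi_s^i(R)=\{Q\in\Psi_s:\dim\langle P,R,Q\rangle=i\}$, and let $\mathcal{S}_{rs}(P)=\{R'\in\Psi_r\setminus\{P\}: P+R'\in\Psi_s\}$. Then $|\Psi_s^1(R)|=1$ if $l=r=s$ and $R=P$, and $|\Psi_s^1(R)|=0$ otherwise. Furthermore: (1) If $l\ne r$, $r\ne s$, $s\ne l$: $|\Psi_s^2(R)|=1$ if $R\in\mathcal{S}_{rs}(P)$ and $0$ otherwise; $|\Psi_s^3(R)|=|\Psi_s|-1$ if $R\in\mathcal{S}_{rs}(P)$ and $|\Psi_s|$ otherwise. (2) If $l=r=s$: $|\Psi_s^2(R)|=3$ if $R\in\mathcal{S}_{rs}(P)$, $|\Psi_s|-1$ if $R=P$, and $2$ otherwise; $|\Psi_s^3(R)|=|\Psi_s|-3$ if $R\in\mathcal{S}_{rs}(P)$, $0$ if $R=P$, and $|\Psi_s|-2$ otherwise. (3) If $l=r\ne s$: $|\Psi_s^2(R)|=1$ if $R\in\mathcal{S}_{rs}(P)$, $|\Psi_s|$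 if $R=P$, and $0$ otherwise; $|\Psi_s^3(R)|=|\Psi_s|-1$ if $R\in\mathcal{S}_{rs}(P)$, $0$ if $R=P$, and $|\Psi_s|$ otherwise. (4) If $l\ne r=s$: $|\Psi_s^2(R)|=2$ if $R\in\mathcal{S}_{rs}(P)$ and $1$ otherwise; $|\Psi_s^3(R)|=|\Psi_s|-2$ if $R\in\mathcal{S}_{rs}(P)$ and $|\Psi_s|-1$ otherwise.
   Context: Points are the $1$-dimensional subspaces of $\mathbb{F}_2^v$, $\Psi$ is the set of all points. For two distinct points $P,R$ of $\mathbb{F}_2^v$, $P+R$ denotes the third point of the $2$-dimensional subspace $\langle P,R\rangle$ (i.e. spanned by the sum of the nonzero vectors of $P$ and $R$). A design over $\mathbb{F}_2$ with parameters $2$-$(v,k,\lambda_2)$ is a finite set $\mathcal{B}$ of $k$-dimensional subspaces (blocks) of $\mathbb{F}_2^v$ such that every $2$-dimensional subspace is contained in exactly $\lambda_2$ blocks. An automorphism group is a subgroup $G\le GL_v(2)$ with $\Phi\mathcal{B}=\mathcal{B}$ for all $\Phi\in G$. The $G$-orbits $\Psi_1,\dots,\Psi_m$ on $\Psi$ and $\mathcal{B}_1,\dots,\mathcal{B}_n$ on $\mathcal{B}$ form a tactical decomposition: there are integers $\rho_{ij}$, $\kappa_{ij}$ with each point of $\Psi_i$ in exactly $\rho_{ij}$ blocks of $\mathcal{B}_j$ and each block of $\mathcal{B}_j$ containing exactly $\kappa_{ij}$ points of $\Psi_i$. *)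

(* Defs.v *)
From HB Require Import structures.
From mathcomp Require Import all_boot all_order all_fingroup all_algebra.

Set Implicit Arguments.
Unset Strict Implicit.
Unset Printing Implicit Defensive.

Import GRing.Theory.
Local Open Scope ring_scope.

Section FiniteVspace.
Import VectorInternalTheory.
Variables (K : finFieldType) (vT : vectType K).
HB.instance Definition _ := [Countable of {vspace vT} by <:].
HB.instance Definition _ := [Finite of {vspace vT} by <:].
End FiniteVspace.

(* The group type {'GL_v(2)} of the library consists of matrices of size
   v.-1.+1, so the space it acts on is taken with that dimension, which is v as
   soon as 0 < v. *)
Notation F2 v := ('rV['F_2]_(v.-1.+1)).
Notation subspace v := {vspace F2 v}.

Section SubspaceAction.
Variable v : nat.
Implicit Types (U : subspace v) (g : {'GL_v(2)}).

(* Matrices act on row vectors from the right, so that this is an action in the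
   sense of the library. *)
Definition subspace_act U g : subspace v :=
  (linfun (mulmxr (GLval g) : F2 v -> F2 v) @: U)%VS.

Lemma subspace_act1 U : subspace_act U 1%g = U.
Proof.
rewrite /subspace_act (_ : linfun _ = \1%VF) ?lim1g //.
by apply/lfunP=> u; rewrite lfunE /= id_lfunE -[RHS]mulmx1.
Qed.

Lemma subspace_actM U g h :
  subspace_act U (g * h)%g = subspace_act (subspace_act U g) h.
Proof.
rewrite /subspace_act -limg_comp; congr (_ @: U)%VS.
by apply/lfunP=> u; rewrite comp_lfunE !lfunE /= -mulmxA.
Qed.

Canonical subspace_action := TotalAction subspace_act1 subspace_actM.

End SubspaceAction.

Definition points v : {set subspace v} := [set U | \dim U == 1%N].

(* On a 1-dimensional subspace over 'F_2, [vpick] returns its unique nonzero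
   vector. Meaningful for distinct points only: [point_add P P = 0%VS]. *)
Definition point_add v (P R : subspace v) : subspace v :=
  <[vpick P + vpick R]>%VS.

Definition is_design2 v (k lam : nat) (B : {set subspace v}) : Prop :=
  (forall U, U \in B -> \dim U = k) /\
  (forall T : subspace v, \dim T = 2%N -> #|[set U in B | (T <= U)%VS]| = lam).

Definition is_automorphism_group v (B : {set subspace v})
    (G : {group {'GL_v(2)}}) : Prop :=
  forall g, g \in G -> [set subspace_act U g | U in B] = B.

(* [C] lists the G-orbits on [X], each exactly once. *)
Definition orbit_decomposition v (G : {group {'GL_v(2)}})
    (X : {set subspace v}) (m : nat) (C : 'I_m -> {set subspace v}) : Prop :=
  injective C /\
  [set C i | i : 'I_m] = [set orbit (@subspace_action v) G U | U in X].

Definition span_dim_set v (O : {set subspace v}) (P R : subspace v) (i : nat) :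
  {set subspace v} := [set Q in O | \dim (P + R + Q)%VS == i].

Definition third_point_set v (Or Os : {set subspace v}) (P : subspace v) :
  {set subspace v} := [set R' in Or :\ P | point_add P R' \in Os].

(* Main.v *)
Require Import Defs.
From mathcomp Require Import all_boot all_order all_fingroup all_algebra.
From mathcomp Require Import zify.

Set Implicit Arguments.
Unset Strict Implicit.
Unset Printing Implicit Defensive.

Import GRing.Theory.
Local Open Scope ring_scope.

(** Over 'F_2 the line through two distinct points P and R has exactly the three
points P, R and P + R. Hence a point Q spans with P and R a space of dimension 2
if Q is one of these, and of dimension 3 otherwise; each of the stated
cardinalities counts which of the three points lie in the orbit Psi_s. *)

Section Points.

Variable v : nat.
Implicit Types (U P Q R : subspace v) (O : {set subspace v}).

Lemma mem_pointsP P : reflect (\dim P = 1%N) (P \in points v).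
Proof. by rewrite inE; apply: eqP. Qed.

Lemma vpick_point_neq0 P : P \in points v -> vpick P != 0.
Proof. by move/mem_pointsP => dP; rewrite vpick0 -dimv_eq0 dP. Qed.

Lemma pointE P : P \in points v -> P = <[vpick P]>%VS.
Proof.
move=> pP; apply/esym/eqP; have /mem_pointsP dP := pP.
have le : (<[vpick P]> <= P)%VS by rewrite -memvE memv_pick.
by rewrite eqEdim le dim_vline vpick_point_neq0 // dP.
Qed.

Lemma point_sub P Q :
  P \in points v -> Q \in points v -> (P <= Q)%VS = (P == Q).
Proof.
by move=> /mem_pointsP dP /mem_pointsP dQ; rewrite eqEdim dP dQ andbT.
Qed.

(** The intersection of [U] with a point has dimension 0 or 1, and dimension 1 forces it to be the
    whole point; the rest is the dimension formula. *)
Lemma dim_add_point U P :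
  P \in points v -> \dim (U + P) = (\dim U + ~~ (P <= U)%VS)%N.
Proof.
move=> /mem_pointsP dP; have [PU|PU] := boolP (P <= U)%VS.
  by rewrite addn0; move/addv_idPl: PU => ->.
have dc : \dim (U :&: P) = 0%N.
  have le : (U :&: P <= P)%VS := capvSr _ _.
  have := dimvS le; rewrite dP leq_eqVlt ltnS leqn0 => /orP[/eqP d1|/eqP //].
  have /eqP e : (U :&: P == P)%VS by rewrite eqEdim le d1 dP.
  by move: PU; rewrite -e capvSl.
by have := dimv_sum_cap U P; rewrite dc dP addn0.
Qed.

Lemma dim_add_points P Q : P \in points v -> Q \in points v ->
  \dim (P + Q) = (1 + (P != Q))%N.
Proof.
move=> pP pQ; rewrite dim_add_point // point_sub // eq_sym.
by move/mem_pointsP: pP => ->.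
Qed.

Lemma F2_cases (a : 'F_2) : a = 0 \/ a = 1.
Proof.
by case: a => [[|[|a]] lta] //; [left|right]; apply: val_inj.
Qed.

(** This is where the field matters: coefficients in ['F_2] are 0 or 1, so the only nonzero
    combinations of two vectors are the vectors themselves and their sum. *)
Lemma point_sub_line P R Q :
    P \in points v -> R \in points v -> Q \in points v ->
  (Q <= P + R)%VS = (Q \in [set P; R; point_add P R]).
Proof.
move=> pP pR pQ; rewrite !inE; apply/idP/idP; last first.
  case/orP => [/orP[]|] /eqP ->; [exact: addvSl | exact: addvSr |].
  by rewrite -memvE memv_add ?memv_pick.
have nzQ := vpick_point_neq0 pQ; have defQ := pointE pQ.
rewrite {1}defQ -memvE => /memv_addP[p Pp [r Rr eqQ]].
move: Pp Rr; rewrite (pointE pP) (pointE pR) => /vlineP[a def_p] /vlineP[b def_r].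
move: nzQ defQ; rewrite -(pointE pP) -(pointE pR) eqQ def_p def_r => nz ->.
(* Of the four coefficient pairs, (0, 0) contradicts [nz]; the other three give [R], [P] and
   [point_add P R]. *)
move: nz; case: (F2_cases a) => ->; case: (F2_cases b) => ->;
  by rewrite ?scale0r ?scale1r ?add0r ?addr0 -?(pointE pP) -?(pointE pR)
             ?eqxx ?orbT.
Qed.

(** If the sum vector lay in [P], subtracting the vector of [P] would put [R] inside [P], and
    symmetrically. The three points of the line are thus counted without overlap. *)
Lemma point_add_notin P R : P \in points v -> R \in points v -> P != R ->
  point_add P R \notin [set P; R].
Proof.
move=> pP pR neq; rewrite !inE negb_or.
have mem_sum : vpick P + vpick R \in point_add P R by exact: memv_line.
apply/andP; split; apply/eqP=> e; move: mem_sum; rewrite e.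
  rewrite rpredDl ?memv_pick // memvE -(pointE pR) point_sub //.
  by rewrite eq_sym (negPf neq).
by rewrite rpredDr ?memv_pick // memvE -(pointE pP) point_sub // (negPf neq).
Qed.

Section SpanDimSets.

Variables (O : {set subspace v}) (P R : subspace v).
Hypotheses (sO : O \subset points v) (pP : P \in points v) (pR : R \in points v).

(** For [R = P] the span is just [P + Q], of dimension 1 or 2 according to whether [Q] is [P]. *)
Lemma card_span_dim_diag :
  [/\ #|span_dim_set O P P 1| = (P \in O),
      #|span_dim_set O P P 2| = (#|O| - (P \in O))%N
    & #|span_dim_set O P P 3| = 0%N].
Proof.
have dimE Q : Q \in O -> \dim (P + P + Q) = (1 + (Q != P))%N.
  by move=> /(subsetP sO) pQ; rewrite addvv dim_add_points // [P == Q]eq_sym.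
split.
- rewrite (_ : span_dim_set _ _ _ _ = O :&: [set P]).
    by rewrite (cardsD1 P) !inE eqxx andbT setDIl setDv setI0 cards0 addn0.
  apply/setP=> Q; rewrite !inE; case: (boolP (Q \in O)) => //= QO.
  by rewrite dimE //; case: (Q == P).
- rewrite (_ : span_dim_set _ _ _ _ = O :\ P).
    by rewrite (cardsD1 P O) addKn.
  apply/setP=> Q; rewrite !inE andbC; case: (boolP (Q \in O)) => //= QO.
    by rewrite dimE // andbT; case: (Q == P).
  by rewrite !andbF.
- apply/eqP; rewrite cards_eq0; apply/eqP/setP=> Q; rewrite !inE.
  by case: (boolP (Q \in O)) => //= QO; rewrite dimE //; case: (Q == P).
Qed.

(** The dimensions 2 and 3 split [O] into its points on and off the line [P + R]. The last count is
    stated as a sum to avoid truncated subtraction. *)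
Lemma card_span_dim_neq : P != R ->
  [/\ #|span_dim_set O P R 1| = 0%N,
      #|span_dim_set O P R 2| = ((P \in O) + (R \in O) + (point_add P R \in O))%N
    & (#|span_dim_set O P R 2| + #|span_dim_set O P R 3|)%N = #|O|].
Proof.
move=> neq; set L := [set P; R; point_add P R].
have dimE Q : Q \in O -> \dim (P + R + Q) = (2 + (Q \notin L))%N.
  move=> /(subsetP sO) pQ.
  by rewrite dim_add_point // dim_add_points // neq point_sub_line.
have E2 : span_dim_set O P R 2 = O :&: L.
  apply/setP=> Q; rewrite [LHS]inE [RHS]inE; case: (boolP (Q \in O)) => //= QO.
  by rewrite dimE //; case: (Q \in L).
have E3 : span_dim_set O P R 3 = O :\: L.
  apply/setP=> Q; rewrite [LHS]inE [RHS]inE andbC.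
  case: (boolP (Q \in O)) => QO; last by rewrite !andbF.
  by rewrite !andbT dimE //; case: (Q \in L).
split; last by rewrite E2 E3 cardsID.
  apply/eqP; rewrite cards_eq0; apply/eqP/setP=> Q; rewrite !inE.
  by case: (boolP (Q \in O)) => //= QO; rewrite dimE.
(* Summing over the line [L] instead of [O] lets its three points be peeled off one by one. *)
rewrite E2 -sum1_card (eq_bigl (fun Q => (Q \in L) && (Q \in O))); last first.
  by move=> Q; rewrite inE andbC.
have nL := point_add_notin pP pR neq.
rewrite big_mkcondr /L setUC big_setU1 //= setUC big_setU1 ?inE 1?eq_sym //=.
rewrite big_set1.
by do 3 case: (_ \in O).
Qed.

End SpanDimSets.

Section OrbitDecomposition.

Variables (G : {group {'GL_v(2)}}) (m : nat) (Psi : 'I_m -> {set subspace v}).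

(** Both classes would be the orbit of [P], and injectivity of [Psi] then identifies their
    indices. *)
Lemma orbit_decomposition_eq (X : {set subspace v}) (i j : 'I_m) P :
  orbit_decomposition G X Psi -> P \in Psi i -> (P \in Psi j) = (i == j).
Proof.
move=> [injPsi eqPsi] Pi; apply/idP/eqP => [Pj|<- //].
have orbE k : P \in Psi k -> Psi k = orbit (@subspace_action v) G P.
  have : Psi k \in [set orbit (@subspace_action v) G U | U in X].
    by rewrite -eqPsi imset_f.
  by case/imsetP=> U _ -> /orbit_eqP ->.
by apply: injPsi; rewrite (orbE i Pi) (orbE j Pj).
Qed.

(** An invertible matrix has trivial kernel, so it maps [U] injectively. *)
Lemma subspace_act_dim U g : \dim (subspace_act U g) = \dim U.
Proof.
apply: limg_dim_eq; apply/eqP; rewrite -subv0; apply/subvP=> u.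
rewrite memv_cap memv_ker lfunE /= => /andP[_ /eqP u0]; rewrite memv0.
by rewrite -[u](mulmxK (GL_unitmx g)) u0 mul0mx.
Qed.

Lemma orbit_decomposition_points (i : 'I_m) :
  orbit_decomposition G (points v) Psi -> Psi i \subset points v.
Proof.
move=> [_ eqPsi].
have : Psi i \in [set orbit (@subspace_action v) G U | U in points v].
  by rewrite -eqPsi imset_f.
case/imsetP=> U /mem_pointsP dU ->; apply/subsetP=> _ /orbitP[g _ <-].
by apply/mem_pointsP; rewrite /= subspace_act_dim.
Qed.

End OrbitDecomposition.

End Points.

Theorem mainTheorem3 (v k lam : nat) (hv : (0 < v)%N)
  (B : {set subspace v}) (hB : is_design2 k lam B)
  (G : {group {'GL_v(2)}}) (hG : is_automorphism_group B G)
  (m n : nat) (Psi : 'I_m -> {set subspace v}) (Bl : 'I_n -> {set subspace v})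
  (hPsi : orbit_decomposition G (points v) Psi)
  (hBl : orbit_decomposition G B Bl)
  (l r s : 'I_m) (P R : subspace v) (hP : P \in Psi l) (hR : R \in Psi r) :
  let S := third_point_set (Psi r) (Psi s) P in
  let Psi1 := span_dim_set (Psi s) P R 1 in
  let Psi2 := span_dim_set (Psi s) P R 2 in
  let Psi3 := span_dim_set (Psi s) P R 3 in
  let card (X : {set subspace v}) : int := #|X|%:Z in
  card Psi1 = (if [&& l == r, r == s & R == P] then 1 else 0) /\
  [/\ (l <> r -> r <> s -> s <> l ->
        card Psi2 = (if R \in S then 1 else 0) /\
        card Psi3 = (if R \in S then card (Psi s) - 1 else card (Psi s))),
      (l = r -> r = s ->
        card Psi2 = (if R \in S then 3
                     else if R == P then card (Psi s) - 1 else 2) /\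
        card Psi3 = (if R \in S then card (Psi s) - 3
                     else if R == P then 0 else card (Psi s) - 2)),
      (l = r -> r <> s ->
        card Psi2 = (if R \in S then 1
                     else if R == P then card (Psi s) else 0) /\
        card Psi3 = (if R \in S then card (Psi s) - 1
                     else if R == P then 0 else card (Psi s)))
    & (l <> r -> r = s ->
        card Psi2 = (if R \in S then 2 else 1) /\
        card Psi3 = (if R \in S then card (Psi s) - 2
                     else card (Psi s) - 1))].
Proof.
move=> S Psi1 Psi2 Psi3 card.
have sub i : Psi i \subset points v := orbit_decomposition_points i hPsi.
have pP := subsetP (sub l) _ hP; have pR := subsetP (sub r) _ hR.
have memP i := orbit_decomposition_eq i hPsi hP.
have memR i := orbit_decomposition_eq i hPsi hR.
have RS : (R \in S) = (R != P) && (point_add P R \in Psi s).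
  by rewrite !inE hR andbT.
rewrite RS {S RS} /card /Psi1 /Psi2 /Psi3 {Psi1 Psi2 Psi3 card}.
have [eRP|nRP] := eqVneq R P.
  have elr : l = r by apply/eqP; rewrite -memP -eRP.
  (* Positivity turns the natural-number difference [#|Psi s| - 1] into the integer one. *)
  have pos : (l == s -> 0 < #|Psi s|)%N.
    by rewrite -memP => PO; apply/card_gt0P; exists P.
  rewrite eRP; have [-> -> ->] := card_span_dim_diag (sub s) pP.
  rewrite memP -elr eqxx /=.
  split; first by case: (l == s).
  (* Cases (1) and (4) assume [l <> r] and are vacuous here. *)
  split=> // h1 h2.
  - by move: pos; rewrite h2 eqxx => /(_ isT) pos; rewrite -subzn.
  - by move/eqP/negPf: h2 => ->; rewrite subn0.
have nPR : P != R by rewrite eq_sym.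
have [-> card2 card23] := card_span_dim_neq (sub s) pP pR nPR.
rewrite -card23 card2 memP memR !andbF /=; split=> //.
(* The hypotheses of each case decide [l == s] and [r == s], that is, whether [P] and [R] lie in
   [Psi s]; only the third point of the line is left to split on. *)
split=> [/eqP/negPf _ /eqP/negPf -> /eqP/negPf | -> -> | -> /eqP/negPf ->
        | /eqP/negPf nlr <-]; rewrite ?[s == l]eq_sym ?eqxx ?nlr.
- by move=> ->; case: (_ \in Psi s) => /=; split; lia.
- by case: (_ \in Psi s) => /=; split; lia.
- by case: (_ \in Psi s) => /=; split; lia.
- by case: (_ \in Psi r) => /=; split; lia.
Qed.
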